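(* Let $n\ge0$, $k>0$ and $i\in\{0,1\}$. Every irreducible component $C$ of the set $\{(c,a)\in\mathbb{C}^2:\ P^{n+k}_{c,a}(c_i)=P^n_{c,a}(c_i)\}$ contains infinitely many post-critically finite parameters.
   Context: $P_{c,a}(z)=\frac13z^3-\frac c2z^2+a^3$ with critical points $c_0=0$, $c_1=c$; a parameter is post-critically finite if both critical points have finite forward orbits. *)

(* Defs.v *)
From HB Require Import structures.
From mathcomp Require Import all_boot all_order all_algebra.
From mathcomp Require Import reals.
From mathcomp Require Import complex.
Set Implicit Arguments. Unset Strict Implicit. Unset Printing Implicit Defensive.
Import Order.TTheory GRing.Theory Num.Theory.
Local Open Scope ring_scope.

Section Defs.
Variable R : realType.
Local Notation C := (R[i]).

Definition Pca (c a : C) (z : C) : C := z ^+ 3 / 3%:R - c / 2%:R * z ^+ 2 + a ^+ 3.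

Definition crit (c : C) (i : bool) : C := if i then c else 0.

Definition Piter (n : nat) (c a z : C) : C := iter n (Pca c a) z.

Definition finite_orbit (f : C -> C) (x : C) : Prop :=
  exists s : seq C, forall j : nat, iter j f x \in s.

Definition pcf (z : C * C) : Prop :=
  finite_orbit (Pca z.1 z.2) (crit z.1 false) /\
  finite_orbit (Pca z.1 z.2) (crit z.1 true).

(* Polynomials in the two variables (c,a): outer variable a, inner variable c. *)
Definition peval2 (p : {poly {poly C}}) (z : C * C) : C := (p.[z.2%:P]).[z.1].

Definition subset2 (A B : C * C -> Prop) : Prop := forall z, A z -> B z.

Definition zclosed (S : C * C -> Prop) : Prop :=
  exists F : {poly {poly C}} -> Prop,
    forall z, S z <-> (forall p, F p -> peval2 p z = 0).

Definition zirreducible (S : C * C -> Prop) : Prop :=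
  [/\ zclosed S, exists z, S z &
    forall A B, zclosed A -> zclosed B -> (forall z, S z -> A z \/ B z) ->
      subset2 S A \/ subset2 S B].

Definition irr_component (V K : C * C -> Prop) : Prop :=
  [/\ zirreducible K, subset2 K V &
    forall D, zirreducible D -> subset2 K D -> subset2 D V -> subset2 D K].

Definition preper_locus (n k : nat) (i : bool) (z : C * C) : Prop :=
  Piter (n + k) z.1 z.2 (crit z.1 i) = Piter n z.1 z.2 (crit z.1 i).

Definition infinite2 (S : C * C -> Prop) : Prop :=
  forall s : seq (C * C), exists z, S z /\ z \notin s.
End Defs.

(* Main.v *)
Require Import Defs.
From HB Require Import structures.
From mathcomp Require Import all_boot all_order all_algebra.
From mathcomp Require Import reals boolp.
From mathcomp Require Import complex.
From mathcomp Require Import ring lra zify.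
Set Implicit Arguments. Unset Strict Implicit. Unset Printing Implicit Defensive.
Import Order.TTheory GRing.Theory Num.Theory.
Local Open Scope ring_scope.

(** The relation [P^(n+k)(c_i) = P^n(c_i)] is, up to a constant, monic in [a], so a
    component [K] is a curve [f = 0] with [f] monic in [a] and irreducible.  Let
    [Q = P^n(c_i)], which is [k]-periodic on [K], let [c_j] be the other critical
    point, [G_t = P^(kt)(c_j)], [D_t = G_t - Q], and write
    [P(G_t) - P(Q) = D_t^s h_t], where [h_t] is congruent modulo [D_t] to a fixed [l];
    one can take [s = 1] or [2] so that [l] is not identically zero on [K], unless
    every point of [K] is post-critically finite.  At a zero of some [D_t] the point
    [c_j] lands on the orbit of [c_i].  If there are only finitely many post-critically
    finite parameters on [K], then for some [M] every zero of every [h_t] is a zero of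
    [D_M]; since [D_(t+1)] is a multiple of [D_t h_t], [h_t] tends [D_M]-adically
    to [l], which forces [h_t] to divide [l] on [K] for large [t].  Hence the
    degree of the norm of [h_t] to [C[c]] is bounded.  But for large [c] the critical point
    [c_j] escapes and [|h_t| >= |c|^(kt) / 8] at every point of [K] above [c]. *)

(** * Plane curves monic in one variable *)

Section PlaneCurves.
Variable C : closedFieldType.
Implicit Types (p q f g h w v : {poly {poly C}}) (c a : C).

(** The outer variable is [a], so monic means monic in [a], and the roots of [fibre c p] are the
    second coordinates of the zeros of [p] above [c]. *)
Definition ev p c a : C := (p.[a%:P]).[c].
Definition fibre c p : {poly C} := map_poly (horner_eval c) p.

Lemma evD p q c a : ev (p + q) c a = ev p c a + ev q c a.
Proof. by rewrite /ev !hornerD. Qed.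

Lemma evN p c a : ev (- p) c a = - ev p c a.
Proof. by rewrite /ev !hornerN. Qed.

Lemma evM p q c a : ev (p * q) c a = ev p c a * ev q c a.
Proof. by rewrite /ev !hornerM. Qed.

Lemma evX p n c a : ev (p ^+ n) c a = ev p c a ^+ n.
Proof. by rewrite /ev !horner_exp. Qed.

Lemma evC (r : {poly C}) c a : ev r%:P c a = r.[c].
Proof. by rewrite /ev hornerC. Qed.

Lemma ev0 c a : ev 0 c a = 0.
Proof. by rewrite /ev !horner0. Qed.

Lemma ev1 c a : ev 1 c a = 1.
Proof. by rewrite evC hornerC. Qed.

Lemma evCC b c a : ev b%:P%:P c a = b.
Proof. by rewrite evC hornerC. Qed.

Definition evE := (evD, evN, evM, evX, ev0, ev1, evCC, evC).

Lemma ev_fibre p c a : ev p c a = (fibre c p).[a].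
Proof.
have -> : a = horner_eval c a%:P by rewrite /horner_eval hornerC.
by rewrite /fibre horner_map /= /horner_eval hornerC.
Qed.

Lemma fibre_monic c f : f \is monic -> fibre c f \is monic.
Proof. exact: monic_map. Qed.

Lemma size_fibre c f : f \is monic -> size (fibre c f) = size f.
Proof.
by move=> /monicP f1; apply: size_map_poly_id0; rewrite f1 rmorph1 oner_neq0.
Qed.

Lemma fibre_roots c f : f \is monic ->
  {rs : seq C | fibre c f = \prod_(z <- rs) ('X - z%:P) & size rs = (size f).-1}.
Proof.
move=> mf; have [rs] := closed_field_poly_normal (fibre c f).
rewrite (monicP (fibre_monic c mf)) scale1r => E; exists rs => //.
by rewrite -(size_fibre c mf) E size_prod_XsubC.
Qed.

Lemma curve_point f c : f \is monic -> (1 < size f)%N -> exists a, ev f c a = 0.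
Proof.
move=> mf sf; have /closed_rootP[a /rootP fa] : size (fibre c f) != 1%N.
  by rewrite size_fibre // neq_ltn sf orbT.
by exists a; rewrite ev_fibre.
Qed.

Lemma fibre_eq0 c p : fibre c p = 0 -> exists q, p = ('X - c%:P) *: q.
Proof.
move=> p0; exists (map_poly (fun s => s %/ ('X - c%:P)) p).
apply/polyP=> i; rewrite coefZ coef_map_id0 ?div0p // mulrC divpK //.
rewrite dvdp_XsubCl; apply/rootP.
by have /polyP/(_ i) := p0; rewrite coef_map coef0.
Qed.

Lemma fibre_eq c p q : fibre c p = fibre c q ->
  exists g, p = q + ('X - c%:P)%:P * g.
Proof.
move=> E; have [|g Eg] := @fibre_eq0 c (p - q).
  by rewrite /fibre rmorphB /= -/(fibre c p) E subrr.
by exists g; rewrite mul_polyC -Eg addrC subrK.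
Qed.

Lemma fibre_polyC c (p : {poly C}) : fibre c (map_poly polyC p) = p.
Proof.
by apply/polyP=> i; rewrite !coef_map /= /horner_eval hornerC.
Qed.

Lemma fibreCC b c : fibre c b%:P%:P = b%:P.
Proof. by rewrite /fibre map_polyC /= /horner_eval hornerC. Qed.

(** For nonconstant [r], the polynomial [r + 1] has a root, and there [r] takes the value -1. *)
Lemma exists_nonroot (r : {poly C}) : r != 0 -> exists c, r.[c] != 0.
Proof.
move=> r0; case: (eqVneq (size r) 1%N) => [/eqP/size_poly1P[k k0 ->]|sr].
  by exists 0; rewrite hornerC.
have sr1 : size (r + 1) = size r.
  by rewrite size_polyDl // size_poly1 ltn_neqAle eq_sym sr size_poly_gt0.
have /closed_rootP[c /rootP] : size (r + 1) != 1%N by rewrite sr1.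
rewrite hornerD hornerC => rc; exists c; apply/eqP => rc0.
by move/eqP: rc; rewrite rc0 add0r oner_eq0.
Qed.

Lemma poly_fun_eq (r s : {poly C}) : (forall c, r.[c] = s.[c]) -> r = s.
Proof.
move=> E; apply/eqP; rewrite -subr_eq0; apply/negPn/negP=> /exists_nonroot[c].
by rewrite hornerD hornerN E subrr eqxx.
Qed.

(* Gauss's lemma for [C[c][a]]: a pseudo-factorisation of a monic polynomial
   can be rescaled, one prime [c - c0] of the content at a time. *)
Lemma gauss_monic (s : {poly C}) f w v : s != 0 -> f \is monic ->
  s *: f = w * v ->
  exists w' v', [/\ w' \is monic, v' \is monic, f = w' * v',
                    size w' = size w & size v' = size v].
Proof.
have [n] := ubnP (size s); elim: n => // n IH in s w v * => sn s0 mf E.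
case: (eqVneq (size s) 1%N) => [/eqP/size_poly1P[k k0 sk]|ss].
  have us : s \is a GRing.unit by rewrite poly_unitE sk size_polyC k0 coefC unitfE.
  have lE : lead_coef w * lead_coef v = s.
    by rewrite -lead_coefM -E lead_coefZ (monicP mf) mulr1.
  have /andP[uw uv] : (lead_coef w \is a GRing.unit) && (lead_coef v \is a GRing.unit).
    by rewrite -unitrM lE.
  exists ((lead_coef w)^-1 *: w), ((lead_coef v)^-1 *: v).
  split; rewrite ?monicE ?lead_coefZ ?mulVr ?size_scale ?invr_eq0 //.
  - by rewrite -scalerAl -scalerAr scalerA -E scalerA -invrM //
       [_ * lead_coef w]mulrC lE mulVr // scale1r.
  - by apply: contraTneq uw => ->; rewrite unitr0.
  - by apply: contraTneq uv => ->; rewrite unitr0.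
have /closed_rootP[c rc] := ss.
have [s' Es] := factor_theorem s c rc.
have X0 : 'X - c%:P != 0 :> {poly C} by rewrite polyXsubC_eq0.
have X0P : ('X - c%:P)%:P != 0 :> {poly {poly C}} by rewrite polyC_eq0.
have s'0 : s' != 0 by apply: contraNneq s0 => s'0; rewrite Es s'0 mul0r.
have s'n : (size s' < n)%N.
  by move: sn; rewrite Es size_Mmonic ?monicXsubC // size_XsubC addn2 /= ltnS.
(* Since [C[a]] is a domain, a root [c] of [s] kills one of the two fibres; then ['X - c%:P] divides
   [w] or [v] and cancels against [s]. *)
have : fibre c w * fibre c v = 0.
  rewrite /fibre -rmorphM -E -mul_polyC rmorphM /= map_polyC /= /horner_eval.
  by rewrite (rootP rc) mul0r.
move/eqP; rewrite mulf_eq0 => /orP[] /eqP/fibre_eq0[w1 Ew].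
  have E1 : s' *: f = w1 * v.
    by apply: (mulfI X0P); rewrite !mul_polyC scalerA mulrC -Es E Ew -scalerAl.
  have [w' [v' [? ? ? sw ?]]] := IH s' _ _ s'n s'0 mf E1.
  by exists w', v'; split; rewrite // sw Ew size_scale.
have E1 : s' *: f = w * w1.
  by apply: (mulfI X0P); rewrite !mul_polyC scalerA mulrC -Es E Ew -scalerAr.
have [w' [v' [? ? ? ? sv]]] := IH s' _ _ s'n s'0 mf E1.
by exists w', v'; split; rewrite // sv Ew size_scale.
Qed.

(** By Gauss's lemma, monic factors suffice to test a monic [f]. The constant 1 passes the test,
    hence the separate assumption [1 < size f] below. *)
Definition monic_irreducible f := forall w v,
  w \is monic -> v \is monic -> f = w * v -> size w = 1%N \/ size v = 1%N.

(** The resultant in [a] decides. If nonzero, it serves as [r]; if zero, [f] and [g] share a factor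
    of positive degree in [a], which Gauss's lemma and irreducibility identify with [f] up to
    factors from [C[c]]. *)
Lemma dvd_or_bezout f g : f \is monic -> (1 < size f)%N -> monic_irreducible f ->
  (exists q, g = q * f) \/ (exists u v r, r != 0 /\ u * f + v * g = r%:P).
Proof.
move=> mf sf irf; case: (ltnP 1 (size g)) => sg; last first.
  have /size1_polyC Eg := sg; case: (eqVneq g`_0 0) => g0.
    by left; exists 0; rewrite Eg g0 mul0r.
  by right; exists 0, 1, g`_0; split; rewrite // mul0r add0r mul1r.
case: (eqVneq (resultant f g) 0) => [/eqP|r0]; last first.
  have [[u v] _ /= E] := resultant_in_ideal sf sg.
  by right; exists u, v, (resultant f g).
rewrite resultant_eq0 => sw; left.
have /Pdiv.Idomain.dvdpP[[s q] /= s0 Eq] := Pdiv.Idomain.dvdp_gcdl f g.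
have /Pdiv.Idomain.dvdpP[[s2 q2] /= s20 Eq2] := Pdiv.Idomain.dvdp_gcdr f g.
have [q' [w' [mq mw Ef sq sw']]] := gauss_monic s0 mf Eq.
have [sq1|sw1] := irf _ _ mq mw Ef; last by rewrite sw' in sw1; rewrite sw1 in sw.
move: sq1; rewrite sq => /eqP/size_poly1P[q0 q00 Eqq].
have E : (s2 * q0) *: g = (q2 * s%:P) * f.
  rewrite -mulrA mul_polyC Eq Eqq mulrC -scalerA Eq2; rewrite -mul_polyC.
  by rewrite mulrCA mulrA.
(* As [f] is monic, pseudo-divisibility is divisibility: a nonzero scalar multiple of the remainder
   is a multiple of [f] of smaller degree, hence zero. *)
have Eg := Pdiv.RingMonic.rdivp_eq mf g.
exists (Pdiv.Ring.rdivp g f); rewrite {1}Eg.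
suff -> : Pdiv.Ring.rmodp g f = 0 by rewrite addr0.
apply/eqP; rewrite -size_poly_eq0; apply/negPn/negP; rewrite -lt0n => sr.
have sr' := Pdiv.Ring.ltn_rmodpN0 g (monic_neq0 mf).
have sq0 : s2 * q0 != 0 by rewrite mulf_neq0.
have : (s2 * q0) *: Pdiv.Ring.rmodp g f =
   (q2 * s%:P - (s2 * q0)%:P * Pdiv.Ring.rdivp g f) * f.
  rewrite mulrBl -E -mulrA mul_polyC {2}Eg scalerDr addrC addKr //.
set k := _ - _ => Ek.
have k0 : k != 0.
  apply: contraTneq sr => k0; rewrite -leqNgt.
  by rewrite -(size_scale _ sq0) Ek k0 mul0r size_poly0.
move/(congr1 (fun p : {poly {poly C}} => size p)): Ek.
rewrite size_scale // size_Mmonic // => Es.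
move: sr'; rewrite Es; rewrite -(prednK (_ : 0 < size k)%N) ?size_poly_gt0 //.
by rewrite addSn /= ltnNge leq_addl.
Qed.

Lemma bezout_of_nonvanishing f g c a : f \is monic -> (1 < size f)%N ->
  monic_irreducible f -> ev f c a = 0 -> ev g c a != 0 ->
  exists u v r, r != 0 /\ u * f + v * g = r%:P.
Proof.
move=> mf sf irf fz gz; have [[q Eg]|//] := dvd_or_bezout g mf sf irf.
by move: gz; rewrite Eg evM fz mulr0 eqxx.
Qed.

Lemma bezout3 (p q s : {poly C}) :
  (forall x, ~ [/\ p.[x] = 0, q.[x] = 0 & s.[x] = 0]) ->
  exists x y z, x * p + y * q + z * s = 1.
Proof.
move=> H; case: (Bezoutp p q) => -[x y] /= E1.
case: (Bezoutp (x * p + y * q) s) => -[u v] /= E2.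
have : size (gcdp (x * p + y * q) s) == 1%N.
  apply/negPn/negP=> /closed_rootP[t]; rewrite root_gcd => /andP[].
  rewrite (eqp_root E1) root_gcd => /andP[/rootP ? /rootP ?] /rootP ?.
  exact: (H t).
rewrite -(eqp_size E2) => /size_poly1P[k k0 Ek].
exists (k^-1%:P * u * x), (k^-1%:P * u * y), (k^-1%:P * v).
transitivity (k^-1%:P * (u * (x * p + y * q) + v * s)); first by ring.
by rewrite Ek -polyCM mulVf.
Qed.

(* Weak Nullstellensatz for three polynomials, two of which have no common
   component: invert modulo each [c - c1] in turn, [c1] a root of the eliminant [r]. *)
Lemma curve_nullstellensatz f h w (u v : {poly {poly C}}) (r : {poly C}) :
  r != 0 -> u * f + v * h = r%:P ->
  (forall c a, ~ [/\ ev f c a = 0, ev h c a = 0 & ev w c a = 0]) ->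
  exists x y z, x * f + y * h + z * w = 1.
Proof.
move=> r0 Er H.
have step c : exists x y z q, x * f + y * h + z * w = 1 + ('X - c%:P)%:P * q.
  have [t|x [y [z E]]] := @bezout3 (fibre c f) (fibre c h) (fibre c w).
    by rewrite -!ev_fibre; apply: H.
  exists (map_poly polyC x), (map_poly polyC y), (map_poly polyC z).
  apply: (@fibre_eq c); rewrite /fibre !(rmorphD, rmorphM) /= rmorph1.
  by rewrite -!/(fibre _ _) !fibre_polyC.
have steps (cs : seq C) : exists x y z q,
    x * f + y * h + z * w = 1 + (\prod_(c <- cs) ('X - c%:P))%:P * q.
  elim: cs => [|c cs [x [y [z [q E]]]]].
    by exists 0, 0, 0, (-1); rewrite big_nil; ring.
  have [x' [y' [z' [q' E']]]] := step c.
  rewrite big_cons polyCM; set X := ('X - c%:P)%:P; set P := (\prod_(_ <- _) _)%:P.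
  (* If [e = 1 + P q] and [e' = 1 + X q'] lie in the ideal, so does [e + e' - e e' = 1 - (1 - e)(1 -
     e') = 1 - X P q q']. *)
  exists (x + x' - x * (x' * f + y' * h + z' * w)), (y + y' - y * (x' * f + y' * h + z' * w)),
    (z + z' - z * (x' * f + y' * h + z' * w)), (- (q * q')).
  transitivity ((x * f + y * h + z * w) + (x' * f + y' * h + z' * w)
      - (x * f + y * h + z * w) * (x' * f + y' * h + z' * w)); first by ring.
  by rewrite E E'; rewrite -/X -/P; ring.
have [rs Ers] := closed_field_poly_normal r.
have [x [y [z [q E]]]] := steps rs.
move: E; set P := \prod_(_ <- _) _ => E.
have l0 : lead_coef r != 0 by rewrite lead_coef_eq0.
have EP : P%:P = (lead_coef r)^-1%:P%:P * (u * f + v * h).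
  by rewrite Er {2}Ers -/P -mul_polyC polyCM mulrA -!polyCM mulVf // mul1r.
exists (x - (lead_coef r)^-1%:P%:P * u * q), (y - (lead_coef r)^-1%:P%:P * v * q), z.
transitivity (x * f + y * h + z * w - (lead_coef r)^-1%:P%:P * (u * f + v * h) * q).
  by ring.
by rewrite E EP; ring.
Qed.

(* Each [d(c1, a) - d(c1, z)] is divisible by [a - z], and [f(c1, a)] is the product
   of the [a - z] over the fibre; so [d] is algebraic over the constants modulo [r]. *)
Lemma constant_equation f d (u l : {poly {poly C}}) (r : {poly C}) v : f \is monic ->
  r != 0 -> u * f + v * l = r%:P ->
  exists (vs : seq C) x y, \prod_(b <- vs) (d - b%:P%:P) = x * f + y * l.
Proof.
move=> mf r0 Er.
have step c : exists (vs : seq C) x y,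
    \prod_(b <- vs) (d - b%:P%:P) = x * f + ('X - c%:P)%:P * y.
  have [rs Ef _] := fibre_roots c mf.
  exists [seq (fibre c d).[z] | z <- rs].
  have [x Ex] : exists x,
    fibre c (\prod_(b <- [seq (fibre c d).[z] | z <- rs]) (d - b%:P%:P)) = x * fibre c f.
    rewrite {}Ef; elim: rs => [|z rs [x IH]].
      by exists 1; rewrite !big_nil /fibre rmorph1 mulr1.
    have /factor_theorem[y Ey] : root (fibre c d - (fibre c d).[z]%:P) z.
      by rewrite rootE hornerD hornerN hornerC subrr.
    exists (x * y); rewrite /= !big_cons {1}/fibre rmorphM rmorphB /= -!/(fibre _ _) IH.
    by rewrite fibreCC Ey; ring.
  exists (map_poly polyC x); apply: fibre_eq.
  by rewrite Ex {2}/fibre rmorphM /= -!/(fibre _ _) fibre_polyC.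
have steps (cs : seq C) : exists (vs : seq C) x y,
    \prod_(b <- vs) (d - b%:P%:P) = x * f + (\prod_(c <- cs) ('X - c%:P))%:P * y.
  elim: cs => [|c cs [vs [x [y E]]]].
    by exists [::], 0, 1; rewrite !big_nil; ring.
  have [vs' [x' [y' E']]] := step c.
  rewrite big_cons polyCM; set X := ('X - c%:P)%:P; set P := (\prod_(_ <- _) _)%:P.
  exists (vs ++ vs'), (x * (x' * f + X * y') + P * y * x'), (y * y').
  by rewrite big_cat /= E E' -/X -/P; ring.
have [rs Ers] := closed_field_poly_normal r.
have [vs [x [y E]]] := steps rs.
move: E; set P := \prod_(_ <- rs) _ => E.
have l0 : lead_coef r != 0 by rewrite lead_coef_eq0.
have EP : P%:P = (lead_coef r)^-1%:P%:P * (u * f + v * l).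
  by rewrite Er {2}Ers -/P -mul_polyC polyCM mulrA -!polyCM mulVf // mul1r.
exists vs, (x + (lead_coef r)^-1%:P%:P * u * y), ((lead_coef r)^-1%:P%:P * v * y).
by rewrite E EP; ring.
Qed.

(** The zero constants give the power of [d]; the others multiply to a nonzero constant modulo [d],
    so the second factor has no zero in common with [d]. *)
Lemma prod_sub_constants d (vs : seq C) : exists N (k : C) b,
  k != 0 /\ \prod_(x <- vs) (d - x%:P%:P) = d ^+ N * (k%:P%:P + d * b).
Proof.
elim: vs => [|x vs [N [k [b [k0 E]]]]].
  by exists 0%N, 1, 0; rewrite oner_neq0 big_nil; split=> //; ring.
rewrite big_cons E; case: (eqVneq x 0) => [->|x0].
  by exists N.+1, k, b; split=> //; rewrite exprS; ring.
exists N, (- x * k), (k%:P%:P + d * b - x%:P%:P * b); split.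
  by rewrite mulf_neq0 ?oppr_eq0.
by rewrite !polyCM !polyCN; ring.
Qed.

(* If [h t] tends [d t]-adically to [l], then it divides [l] for large [t]: write
   [d^N y = l v] on the curve with [y] nonvanishing at the zeros of [d := d M]; then
   [y (h t) = l w] where [w] and [h t] have no common zero on the curve. *)
Lemma eventually_divides f l (d h : nat -> {poly {poly C}}) M :
  f \is monic -> (1 < size f)%N -> monic_irreducible f ->
  (exists c a, ev f c a = 0 /\ ev l c a != 0) ->
  (forall t, exists e, forall c a, ev f c a = 0 ->
     ev (d t.+1) c a = ev (d t) c a * ev (h t) c a * ev e c a) ->
  (forall t, exists e, forall c a, ev f c a = 0 ->
     ev (h t) c a = ev l c a + ev (d t) c a * ev e c a) ->
  (forall t c a, ev f c a = 0 -> ev (h t) c a = 0 -> ev (d M) c a = 0) ->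
  exists T, forall t, (T <= t)%N -> exists b, forall c a, ev f c a = 0 ->
    ev l c a = ev (h t) c a * ev b c a.
Proof.
move=> mf sf irf [c0 [a0 [fz lz]]] Hd Hh Hz.
have [u [v [r [r0 Er]]]] := bezout_of_nonvanishing mf sf irf fz lz.
have [vs [x [y Evs]]] := constant_equation (d M) mf r0 Er.
have [N [k [b [k0 Eb]]]] := prod_sub_constants (d M) vs.
have Hy c a : ev f c a = 0 ->
    ev (d M) c a ^+ N * (k + ev (d M) c a * ev b c a) = ev l c a * ev y c a.
  move=> fc; move: (congr1 (fun p => ev p c a) (etrans (esym Eb) Evs)).
  by rewrite !evE fc mulr0 add0r [_ * ev l _ _]mulrC.
(* Modulo [l], each [h t] with [t >= M] is a multiple of [d t], hence of [d M], so every step gains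
   a factor [d M]. *)
have dec s : exists b1 b2, forall c a, ev f c a = 0 -> ev (d (M + s)%N) c a =
    ev (d M) c a * (ev l c a * ev b1 c a + ev (d M) c a ^+ s * ev b2 c a).
  elim: s => [|s [b1 [b2 IH]]].
    by exists 0, 1 => c a _; rewrite addn0 !evE expr0; ring.
  have [e' He'] := Hd (M + s)%N; have [e He] := Hh (M + s)%N.
  set z := l * b1 + d M ^+ s * b2.
  exists ((b1 * (l + d M * z * e) + d M ^+ s * b2) * e'), (b2 * z * e * e') => c a fc.
  by rewrite addnS He' // He // IH // /z !evE exprS; ring.
exists (M + N)%N => t /subnKC <-; rewrite -addnA; move: (t - _)%N => s.
have [b1 [b2 Ed]] := dec (N + s)%N; set T := (M + _)%N in Ed *.
have [e He] := Hh T.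
pose y' := k%:P%:P + d M * b.
(* Multiplying [h T = l + d T * e] by [y'] and replacing [d M ^+ N * y'] by [l * y] makes [l] a
   common factor; [w] is what remains, and it equals [k] where [d M] vanishes. *)
pose w := y' + d M * (y' * b1 + y * d M ^+ s * b2) * e.
have Hw c a : ev f c a = 0 -> ev y' c a * ev (h T) c a = ev l c a * ev w c a.
  move=> fc; have := Hy c a fc.
  rewrite He // Ed // /w /y' !evE exprD => E; rewrite -[RHS]addr0.
  rewrite -[X in _ = _ + X](mul0r (ev (d M) c a * ev (d M) c a ^+ s * ev b2 c a * ev e c a)).
  rewrite -(subrr (ev l c a * ev y c a)) -{1}E; ring.
have hz : ev (h T) c0 a0 != 0.
  apply/eqP=> h0; move: lz; have := He _ _ fz; rewrite h0 Ed // (Hz T) //.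
  by rewrite !mul0r addr0 => <-; rewrite eqxx.
have [u' [v' [r' [r'0 Er']]]] := bezout_of_nonvanishing mf sf irf fz hz.
have [|x1 [x2 [x3 E1]]] := @curve_nullstellensatz f (h T) w u' v' r' r'0 Er'.
  move=> c a [fc hc]; rewrite /w /y' !evE (Hz T) // !mul0r !addr0 => /eqP.
  by rewrite (negPf k0).
(* On the curve [1 = x2 * h T + x3 * w]; multiply by [l] and use [l * w = y' * h T]. *)
clearbody w y'; exists (l * x2 + x3 * y') => c a fc.
have := congr1 (fun p => ev p c a) E1; rewrite !evE fc mulr0 add0r => E1'.
transitivity (ev l c a * (ev x2 c a * ev (h T) c a) + ev x3 c a * (ev l c a * ev w c a)).
  by rewrite -[LHS]mulr1 -E1'; ring.
by rewrite -(Hw c a fc); ring.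
Qed.

(** * Norms from the curve to the [c]-line *)

Lemma horner_char_poly n (B : 'M[C]_n) b : (char_poly B).[b] = \det (b%:M - B).
Proof.
rewrite -[LHS]/(horner_eval b (char_poly B)) -det_map_mx; congr (\det _).
apply/matrixP=> i j; rewrite !mxE /= /horner_eval hornerD hornerN hornerC.
by rewrite hornerMn hornerX.
Qed.

Lemma prod_scale_seq (T : Type) (k : C) (F : T -> C) (s : seq T) :
  \prod_(z <- s) (k * F z) = k ^+ size s * \prod_(z <- s) F z.
Proof.
elim: s => [|z s IH]; first by rewrite !big_nil mulr1.
by rewrite !big_cons IH /= exprS; ring.
Qed.

(** Split [p] into factors ['X - b%:P]: each [\det (B - b%:M)] is, up to sign, the characteristic
    polynomial at [b]; then exchange the two products. *)
Lemma det_horner_mx n (B : 'M[C]_n.+1) (rs : seq C) (p : {poly C}) :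
  char_poly B = \prod_(z <- rs) ('X - z%:P) ->
  \det (horner_mx B p) = \prod_(z <- rs) p.[z].
Proof.
move=> EB; have [bs Ep] := closed_field_poly_normal p.
have srs : size rs = n.+1.
  by have := size_char_poly B; rewrite EB size_prod_XsubC => -[].
rewrite {}Ep; set k := lead_coef p.
transitivity (k ^+ n.+1 * \prod_(b <- bs) \det (B - b%:M)).
  rewrite linearZ /= detZ; congr (_ * _); elim: bs => [|b bs IH].
    by rewrite !big_nil rmorph1 det1.
  rewrite !big_cons rmorphM /= -mulmxE det_mulmx IH rmorphB /= horner_mx_X.
  by rewrite horner_mx_C.
under [RHS]eq_bigr do rewrite hornerZ horner_prod.
rewrite prod_scale_seq srs; congr (_ * _).
rewrite exchange_big /=; apply: eq_bigr => b _.
under [RHS]eq_bigr do rewrite hornerXsubC -opprB -mulN1r.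
rewrite prod_scale_seq srs -opprB -scaleN1r detZ -horner_char_poly EB.
by rewrite horner_prod; under eq_bigr do rewrite hornerXsubC.
Qed.

(** The norm from [C[c][a]/(f)] to [C[c]] is the determinant of [g] at the companion matrix of [f],
    a construction that commutes with specialising [c]. *)
Lemma curve_norm f g : f \is monic -> (1 < size f)%N ->
  exists N : {poly C}, forall c (rs : seq C),
    fibre c f = \prod_(z <- rs) ('X - z%:P) -> N.[c] = \prod_(z <- rs) ev g c z.
Proof.
move=> mf sf; case E: (size f) sf => [|[|d]] // _.
have Ed : (size f).-1 = d.+1 by rewrite E.
have [A EA] : exists A : 'M[{poly C}]_d.+1, char_poly A = f.
  by move: (companionmxK mf); move: (companionmx f); rewrite Ed => A; exists A.
exists (\det (horner_mx A g)) => c rs Ef.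
rewrite -[LHS]/(horner_eval c _) -det_map_mx map_horner_mx.
under eq_bigr do rewrite ev_fibre.
by apply: det_horner_mx; rewrite -map_char_poly EA.
Qed.

End PlaneCurves.

(** * The cubic family as polynomials in the parameters *)

Section CubicFamily.
Variable C : closedFieldType.

Definition Ppoly (z : {poly {poly C}}) : {poly {poly C}} :=
  (3%:R^-1)%:P%:P * z ^+ 3 - (2%:R^-1 *: 'X)%:P * z ^+ 2 + 'X^3.
Definition crit_poly (i : bool) : {poly {poly C}} := if i then 'X%:P else 0.
Definition orbit_poly (m : nat) i := iter m Ppoly (crit_poly i).

Lemma ev_Ppoly_formula z (c a : C) : ev (Ppoly z) c a =
  ev z c a ^+ 3 / 3%:R - c / 2%:R * ev z c a ^+ 2 + a ^+ 3.
Proof.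
rewrite /Ppoly evD evD evN (evM _%:P%:P) (evM (_ *: _)%:P) !evX evCC evC.
rewrite hornerZ hornerX [ev 'X _ _]/ev hornerX hornerC.
by rewrite [X in X - _]mulrC [X in _ - X * _]mulrC.
Qed.

Lemma ev_crit_poly i (c a : C) : ev (crit_poly i) c a = if i then c else 0.
Proof. by case: i; rewrite /= ?ev0 // evC hornerX. Qed.

Lemma size_crit_poly i : (size (crit_poly i) <= 1)%N.
Proof. by case: i; rewrite /= ?size_poly0 // size_polyC_leq1. Qed.

(** The critical points are free of [a] and the first iterate has leading term [a^3]; afterwards the
    cubic term dominates and the leading coefficient stays free of [c]. *)
Lemma orbit_poly_lead m i : 3%:R != 0 :> C -> exists k : C,
  [/\ k != 0, size (orbit_poly m.+1 i) = (3 ^ m.+1).+1 & lead_coef (orbit_poly m.+1 i) = k%:P].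
Proof.
move=> t3; elim: m => [|m [k [k0 sk lk]]].
  exists 1; rewrite oner_neq0 /orbit_poly /= /Ppoly.
  set q := (X in X + 'X^3).
  have s0 : (size q < size ('X^3 : {poly {poly C}}))%N.
    rewrite size_polyXn /q; have /size1_polyC -> := size_crit_poly i.
    by rewrite -!polyC_exp -!polyCM -polyCN -polyCD (leq_ltn_trans (size_polyC_leq1 _)).
  by rewrite addrC size_polyDl // lead_coefDl // size_polyXn lead_coefXn.
set p := orbit_poly m.+1 i in sk lk *.
have p0 : p != 0 by rewrite -size_poly_gt0 sk.
have sX n : size (p ^+ n) = (3 ^ m.+1 * n).+1.
  by rewrite -[LHS]prednK ?size_poly_gt0 ?expf_neq0 // size_exp sk.
have t0 : 3%:R^-1 != 0 :> C by rewrite invr_eq0.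
have s3 : size ((3%:R^-1)%:P%:P * p ^+ 3) = (3 ^ m.+2).+1.
  by rewrite mul_polyC size_scale ?polyC_eq0 // sX [in RHS]expnS mulnC.
have s2 : (size (- (2%:R^-1 *: 'X)%:P * p ^+ 2 + 'X^3)%R < (3 ^ m.+2).+1)%N.
  have : (3 <= 3 ^ m.+1)%N by rewrite expnS leq_pmulr // expn_gt0.
  rewrite [in X in _ -> X]expnS => le3.
  apply: leq_ltn_trans (size_polyD _ _) _; rewrite size_polyXn gtn_max.
  apply/andP; split; last by lia.
  rewrite -polyCN mul_polyC (leq_ltn_trans (size_scale_leq _ _)) //.
  by rewrite sX; lia.
exists (3%:R^-1 * k ^+ 3); rewrite mulf_neq0 ?expf_neq0 //.
rewrite /orbit_poly iterS -/(orbit_poly m.+1 i) -/p /Ppoly.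
rewrite -addrA -mulNr size_polyDl ?s3 // lead_coefDl ?s3 //; split=> //.
by rewrite mul_polyC lead_coefZ lead_coef_exp lk polyCM polyC_exp.
Qed.

(** The divided difference of [Ppoly], which is the derivative at [y] when [x = y]. *)
Definition Ppoly_diff (x y : {poly {poly C}}) : {poly {poly C}} :=
  (3%:R^-1)%:P%:P * (x ^+ 2 + x * y + y ^+ 2) - (2%:R^-1 *: 'X)%:P * (x + y).

Lemma Ppoly_sub x y : Ppoly x - Ppoly y = (x - y) * Ppoly_diff x y.
Proof. by rewrite /Ppoly /Ppoly_diff; ring. Qed.

(** The factor kept is [Ppoly x - Ppoly y] rather than [x - y], since the former is what contains
    [h_t]. *)
Lemma iter_Ppoly_sub k x y : exists e,
  iter k.+1 Ppoly x - iter k.+1 Ppoly y = (Ppoly x - Ppoly y) * e.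
Proof.
elim: k => [|k [e E]]; first by exists 1; rewrite mulr1.
exists (e * Ppoly_diff (iter k.+1 Ppoly x) (iter k.+1 Ppoly y)).
by rewrite iterS [iter k.+2 Ppoly y]iterS Ppoly_sub E mulrA.
Qed.

Lemma ev_Ppoly_diff x y (c a : C) : ev (Ppoly_diff x y) c a =
  (ev x c a ^+ 2 + ev x c a * ev y c a + ev y c a ^+ 2) / 3%:R
  - c / 2%:R * (ev x c a + ev y c a).
Proof.
rewrite /Ppoly_diff evD evN (evM _%:P%:P) (evM (_ *: _)%:P) !(evD _ _ c a) !evX.
rewrite (evM x) evCC evC.
by rewrite hornerZ hornerX [X in X - _]mulrC [X in _ - X * _]mulrC.
Qed.

(** The second-order divided difference at [x, y, y]. *)
Definition Ppoly_diff2 (x y : {poly {poly C}}) : {poly {poly C}} :=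
  (3%:R^-1)%:P%:P * (x + y + y) - (2%:R^-1 *: 'X)%:P.

Lemma ev_Ppoly_diff2 x y (c a : C) : ev (Ppoly_diff2 x y) c a =
  (ev x c a + ev y c a + ev y c a) / 3%:R - c / 2%:R.
Proof.
rewrite /Ppoly_diff2 evD evN (evM _%:P%:P) !(evD _ _ c a) evCC evC.
by rewrite hornerZ hornerX [X in X - _]mulrC [X in _ - X]mulrC.
Qed.

Lemma size_factor_le (p q : {poly C}) : p * q != 0 -> (size p <= size (p * q)%R)%N.
Proof. by move=> pq0; rewrite dvdp_leq ?dvdp_mulr. Qed.

End CubicFamily.

(** * Irreducible components as irreducible plane curves *)

Section Components.
Variable R : realType.
Local Notation C := (R[i]).
Implicit Types (f g F : {poly {poly C}}) (K V : C * C -> Prop).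

Lemma peval2E f (z : C * C) : peval2 f z = ev f z.1 z.2.
Proof. by []. Qed.

Lemma zclosed_curve f : zclosed (fun z : C * C => ev f z.1 z.2 = 0).
Proof. by exists (eq f) => z; split=> [E p <-|/(_ f erefl)]. Qed.

(** Descent on the degree: if [F] splits properly, irreducibility of [K] places it in the zero set
    of one factor. *)
Lemma monic_factor_on F K : F \is monic -> zirreducible K ->
  (forall z, K z -> ev F z.1 z.2 = 0) ->
  exists f q, [/\ f \is monic, F = f * q, monic_irreducible f &
    forall z, K z -> ev f z.1 z.2 = 0].
Proof.
have [n] := ubnP (size F); elim: n => // n IH in F * => sn mF irK FK.
case: (EM (exists w v, [/\ w \is monic, v \is monic, F = w * v,
   size w != 1%N & size v != 1%N])) => [[w [v [mw mv Fwv sw sv]]]|H]; last first.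
  exists F, 1; split; rewrite ?mulr1 // => w v mw mv E.
  have [?|sw] := eqVneq (size w) 1%N; first by left.
  have [?|sv] := eqVneq (size v) 1%N; first by right.
  by case: H; exists w, v.
have sF : size F = (size w + size v).-1 by rewrite Fwv size_Mmonic ?monic_neq0.
have sw0 : (0 < size w)%N by rewrite size_poly_gt0 monic_neq0.
have sv0 : (0 < size v)%N by rewrite size_poly_gt0 monic_neq0.
have [_ _ irr] := irK.
have [] := irr _ _ (zclosed_curve w) (zclosed_curve v).
- move=> z /FK; rewrite Fwv evM => /eqP; rewrite mulf_eq0.
  by case/orP=> /eqP; [left|right].
- move=> wK; have [|f [q [mf Ew irf fK]]] := IH w _ mw irK wK; first by lia.
  by exists f, (q * v); split; rewrite // Fwv Ew mulrA.
- move=> vK; have [|f [q [mf Ev irf fK]]] := IH v _ mv irK vK; first by lia.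
  by exists f, (q * w); split; rewrite // Fwv Ev mulrC mulrA.
Qed.

(** If neither [A] nor [B] contains the curve, each has an equation that vanishes on the curve only
    above the roots of some nonzero [r]; a point above any other [c] lies in neither. *)
Lemma zirreducible_curve f : f \is monic -> (1 < size f)%N ->
  monic_irreducible f -> zirreducible (fun z : C * C => ev f z.1 z.2 = 0).
Proof.
move=> mf sf irf; split; first exact: zclosed_curve.
  by have [a fa] := curve_point (0 : C) mf sf; exists (0, a).
move=> A B [FA HA] [FB HB] H; apply: contrapT => /not_orP[nA nB].
have wit (S : C * C -> Prop) FS : (forall z, S z <-> (forall p, FS p -> peval2 p z = 0)) ->
    ~ subset2 (fun z => ev f z.1 z.2 = 0) S ->
    exists p r, [/\ FS p, r != 0 & forall c a, ev f c a = 0 -> ev p c a = 0 -> r.[c] = 0].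
  move=> HS /existsNP[z /not_implyP[fz /HS/existsNP[p /not_implyP[Fp /eqP pz]]]].
  have [u [v [r [r0 E]]]] := bezout_of_nonvanishing mf sf irf fz pz.
  exists p, r; split=> // c a fc pc.
  by have := congr1 (fun p => ev p c a) E; rewrite !evE fc pc !mulr0 addr0 => <-.
have [p [r [Fp r0 Hp]]] := wit A FA HA nA.
have [q [s [Fq s0 Hq]]] := wit B FB HB nB.
have [c] := exists_nonroot (mulf_neq0 r0 s0).
have [a fa] := curve_point c mf sf.
rewrite hornerM; have [/HA/(_ p Fp)|/HB/(_ q Fq)] := H (c, a) fa; rewrite peval2E /=.
  by move/(Hp _ _ fa) => ->; rewrite mul0r eqxx.
by move/(Hq _ _ fa) => ->; rewrite mulr0 eqxx.
Qed.

(** The curve of the irreducible factor lies between [K] and the whole locus, so maximality of [K]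
    gives equality. *)
Lemma component_curve F K : F \is monic ->
  irr_component (fun z : C * C => ev F z.1 z.2 = 0) K ->
  exists f, [/\ f \is monic, (1 < size f)%N, monic_irreducible f &
    forall z, K z <-> ev f z.1 z.2 = 0].
Proof.
move=> mF [irK KV maxK].
have [f [q [mf Ff irf fK]]] := monic_factor_on mF irK KV.
have sf : (1 < size f)%N.
  rewrite ltnNge; apply/negP=> sf; have [_ [z Kz] _] := irK.
  have f1 : f = 1 by have := monicP mf; rewrite (size1_polyC sf) lead_coefC => ->.
  by have := fK z Kz; rewrite f1 ev1 => /eqP; rewrite oner_eq0.
exists f; split=> // z; split; first exact: fK.
apply: (maxK _ (zirreducible_curve mf sf irf) fK) => {}z fz.
by rewrite Ff evM fz mul0r.
Qed.

Lemma ev_Ppoly (z : {poly {poly C}}) (c a : C) : ev (Ppoly z) c a = Pca c a (ev z c a).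
Proof. by rewrite ev_Ppoly_formula. Qed.

Lemma ev_iter_Ppoly m (z : {poly {poly C}}) (c a : C) :
  ev (iter m (@Ppoly C) z) c a = Piter m c a (ev z c a).
Proof. by elim: m => //= m IH; rewrite ev_Ppoly IH. Qed.

Lemma ev_orbit_poly m i (c a : C) : ev (orbit_poly C m i) c a = Piter m c a (crit c i).
Proof. by rewrite ev_iter_Ppoly ev_crit_poly. Qed.

(** As [k > 0], the later iterate has the larger degree in [a]; dividing by its constant leading
    coefficient makes the difference monic. *)
Lemma preper_poly n k i : (0 < k)%N -> exists2 F : {poly {poly C}}, F \is monic &
  forall z : C * C, preper_locus n k i z <-> ev F z.1 z.2 = 0.
Proof.
have three_neq0 : 3%:R != 0 :> C by rewrite pnatr_eq0.
case: k => // k _; have [l [l0 sl ll]] := orbit_poly_lead (n + k) i three_neq0.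
have sn : (size (orbit_poly C n i) < size (orbit_poly C (n + k).+1 i))%N.
  rewrite sl; case: n {sl ll} => [|n].
    by rewrite (leq_ltn_trans (size_crit_poly C i)) // ltnS expn_gt0.
  by have [l' [_ -> _]] := orbit_poly_lead n i three_neq0;
     rewrite ltnS ltn_exp2l // !ltnS leq_addr.
exists (l^-1%:P%:P * (orbit_poly C (n + k.+1) i - orbit_poly C n i)).
  rewrite monicE mul_polyC lead_coefZ addnS lead_coefDl ?size_polyN // ll -polyCM mulVf //.
move=> z; rewrite evM evCC evD evN !ev_orbit_poly /preper_locus; split=> [->|/eqP].
  by rewrite subrr mulr0.
by rewrite mulf_eq0 invr_eq0 (negPf l0) subr_eq0 => /eqP.
Qed.
End Components.

(** * Escape of the second critical point *)

Section Growth.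
Variable R : realType.
Local Notation C := (R[i]).
Implicit Types (c a z : C).

(** The norm on [R[i]] takes its values in [R[i]]; its real part brings estimates into [R], where
    [lra] and [nra] apply. *)
Definition nrm z : R := complex.Re `|z|.

Lemma nrmE z : `|z| = (nrm z)%:C%C.
Proof. by rewrite /nrm normc_def. Qed.

Lemma nrm_ge0 z : 0 <= nrm z.
Proof. by rewrite -(lecR 0) -nrmE normr_ge0. Qed.

Lemma nrmM z w : nrm (z * w) = nrm z * nrm w.
Proof. by apply: complexI; rewrite -nrmE normrM !nrmE rmorphM. Qed.

Lemma nrmX z n : nrm (z ^+ n) = nrm z ^+ n.
Proof. by apply: complexI; rewrite -nrmE normrX !nrmE rmorphXn. Qed.

Lemma nrmV z : nrm z^-1 = (nrm z)^-1.
Proof. by apply: complexI; rewrite -nrmE normfV !nrmE fmorphV. Qed.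

Lemma nrm_nat n : nrm n%:R = n%:R.
Proof. by apply: complexI; rewrite -nrmE normr_nat rmorph_nat. Qed.

Lemma nrm_real (x : R) : 0 <= x -> nrm x%:C%C = x.
Proof. by move=> x0; apply: complexI; rewrite -nrmE ger0_norm // lecR. Qed.

Lemma nrmN z : nrm (- z) = nrm z.
Proof. by rewrite /nrm normrN. Qed.

Lemma nrm0 : nrm 0 = 0.
Proof. exact: (nrm_nat 0). Qed.

Lemma nrmD z w : nrm (z + w) <= nrm z + nrm w.
Proof. by rewrite -lecR rmorphD /= -!nrmE ler_normD. Qed.

Lemma nrmB z w : nrm (z - w) <= nrm z + nrm w.
Proof. by rewrite -[nrm w]nrmN nrmD. Qed.

Lemma nrmBl z w : nrm z - nrm w <= nrm (z - w).
Proof. by rewrite lerBlDr (le_trans _ (nrmD _ _)) // subrK. Qed.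

Lemma nrm_prod (T : Type) (s : seq T) (F : T -> C) :
  nrm (\prod_(x <- s) F x) = \prod_(x <- s) nrm (F x).
Proof.
elim: s => [|x s IH]; first by rewrite !big_nil (nrm_nat 1).
by rewrite !big_cons nrmM IH.
Qed.

Lemma nrm_horner_le (p : {poly C}) : exists2 B : R, 0 <= B &
  forall z, 1 <= nrm z -> nrm p.[z] <= B * nrm z ^+ (size p).-1.
Proof.
exists (\sum_(i < size p) nrm p`_i); first by apply: sumr_ge0 => i _; apply: nrm_ge0.
move=> z z1; rewrite horner_coef mulr_suml.
elim/big_ind2: _ => [|x1 y1 x2 y2 h1 h2|i _]; first by rewrite nrm0.
  by rewrite (le_trans (nrmD _ _)) // lerD.
rewrite nrmM nrmX ler_wpM2l ?nrm_ge0 // ler_weXn2l //.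
by rewrite -ltnS (ltn_predK (ltn_ord i)).
Qed.

(** With [X = nrm z], the terms [a^3] and [c z^2 / 2] have modulus at most [X^3 / 64] and [X^3 / 8],
    together less than half of [X^3 / 3]. *)
Lemma Pca_lower c a z (M : R) : nrm c <= M -> nrm a <= M -> 10 <= M ->
  4 * M <= nrm z -> nrm z ^+ 3 / 6 <= nrm (Pca c a z).
Proof.
move=> cM aM M10 zM.
have E : z ^+ 3 / 3%:R = Pca c a z - (a ^+ 3 - c / 2%:R * z ^+ 2).
  by rewrite /Pca; move: (_ / _) (_ / _ * _) (a ^+ 3) => x y t; ring.
have /(congr1 nrm) := E; rewrite nrmM nrmV nrm_nat nrmX => En.
have := nrmB (Pca c a z) (a ^+ 3 - c / 2%:R * z ^+ 2); rewrite -En => H1.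
have := nrmB (a ^+ 3) (c / 2%:R * z ^+ 2);
  rewrite nrmX (nrmM _ (z ^+ 2)) nrmX nrmM nrmV nrm_nat => H2.
have a0 := nrm_ge0 a; have c0 := nrm_ge0 c; have z0 := nrm_ge0 z.
move: (nrm a) (nrm c) (nrm z) a0 c0 z0 cM aM zM H1 H2 => A D X A0 D0 X0 DM AM XM H1 H2.
have A3 : A ^+ 3 <= (X / 4) ^+ 3 by rewrite lerXn2r ?nnegrE //; lra.
have D3 : D * X ^+ 2 <= X / 4 * X ^+ 2 by rewrite ler_wpM2r ?exprn_ge0 //; lra.
have -> : X ^+ 3 / 6 = X ^+ 3 / 3 - X ^+ 3 / 6 by field.
have X3 : 0 <= X ^+ 3 by rewrite exprn_ge0.
have E1 : (X / 4) ^+ 3 = X ^+ 3 / 64 by field.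
have E2 : X / 4 * X ^+ 2 = X ^+ 3 / 4 by field.
have E3 : D / 2 * X ^+ 2 = D * X ^+ 2 / 2 by field.
rewrite E1 in A3; rewrite E2 in D3; rewrite E3 in H2; lra.
Qed.

Lemma Pca_expand c a z (M : R) : nrm c <= M -> nrm a <= M -> 10 <= M ->
  4 * M <= nrm z -> M * nrm z <= nrm (Pca c a z).
Proof.
move=> cM aM M10 zM; apply: le_trans (Pca_lower cM aM M10 zM).
move: (nrm z) zM => X XM; have X0 : 0 <= X by lra.
have -> : X ^+ 3 / 6 = X ^+ 2 / 6 * X by field.
rewrite ler_wpM2r // expr2; nra.
Qed.

Lemma Piter_expand c a z (M : R) m : nrm c <= M -> nrm a <= M -> 10 <= M ->
  4 * M <= nrm z -> M ^+ m * nrm z <= nrm (Piter m c a z).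
Proof.
move=> cM aM M10 zM; have M1 : 1 <= M by lra.
elim: m => [|m IH]; first by rewrite expr0 mul1r.
rewrite exprS -mulrA; apply: le_trans (Pca_expand cM aM M10 _); last first.
  by apply: le_trans zM (le_trans _ IH); rewrite ler_peMl ?nrm_ge0 ?exprn_ege1.
by rewrite ler_wpM2l //; lra.
Qed.

(** An iterate of modulus at least [4 * M] would be carried by [n] more steps to a point fixed by
    [P^k], yet expanded by a factor [M ^+ k]. *)
Lemma preper_bounded n k c a w (M : R) : nrm c <= M -> nrm a <= M -> 10 <= M ->
  (0 < k)%N -> Piter (n + k) c a w = Piter n c a w ->
  forall s, nrm (Piter s c a w) < 4 * M.
Proof.
move=> cM aM M10 k0 E s; rewrite ltNge; apply/negP=> H.
have H1 := Piter_expand n cM aM M10 H; have H2 := H.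
have M1 : 1 <= M by lra.
set z := Piter n c a (Piter s c a w) in H1.
have zM : 4 * M <= nrm z.
  by apply: le_trans H (le_trans _ H1); rewrite ler_peMl ?nrm_ge0 ?exprn_ege1.
have := Piter_expand k cM aM M10 zM.
have -> : Piter k c a z = z.
  transitivity (Piter s c a (Piter (n + k) c a w)).
    by rewrite /z /Piter -!iterD; congr iter; lia.
  by rewrite E /z /Piter -!iterD addnC.
case: k k0 {E} => // k _; rewrite exprS -mulrA.
have : nrm z <= M ^+ k * nrm z by rewrite ler_peMl ?nrm_ge0 ?exprn_ege1.
move: (M ^+ k * nrm z) => Y; nra.
Qed.

(** The critical values are [a^3] and [a^3 - c^3/6]. If [|a| > |c|], both have modulus at least
    [5/6 |a|^3], against boundedness. Otherwise one is below [4 |c|], so the other is at least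
    [|c|^3/6 - 4 |c|]. *)
Lemma crit_escape n k i c a : (0 < k)%N -> preper_locus n k i (c, a) ->
  10 <= nrm c -> [/\ nrm a <= nrm c,
    4 * nrm c <= nrm (Pca c a (crit c (~~ i))) &
    forall s, nrm (Piter s c a (crit c i)) < 4 * nrm c].
Proof.
move=> k0 E c10; set M := Num.max (nrm c) (nrm a).
have cM : nrm c <= M by rewrite le_max lexx.
have aM : nrm a <= M by rewrite le_max lexx orbT.
have M10 : 10 <= M by lra.
have bd := preper_bounded cM aM M10 k0 E.
have P0 : Pca c a 0 = a ^+ 3 by rewrite /Pca !expr0n /= mul0r mulr0 subrr add0r.
have Pc : Pca c a c = a ^+ 3 - c ^+ 3 / 6%:R.
  rewrite /Pca addrC; congr (_ + _).
  have -> : c ^+ 3 / 3%:R - c / 2%:R * c ^+ 2 = - (c ^+ 3 / 6%:R) by field.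
  by [].
have n6 : nrm (c ^+ 3 / 6%:R) = nrm c ^+ 3 / 6 by rewrite nrmM nrmX nrmV nrm_nat.
have n3 : nrm (a ^+ 3) = nrm a ^+ 3 by rewrite nrmX.
have h1 := nrmBl (a ^+ 3) (c ^+ 3 / 6%:R).
have h2 := nrmBl (c ^+ 3 / 6%:R) (a ^+ 3).
rewrite -[in X in _ <= X]nrmN opprB in h2; rewrite n6 n3 in h1 h2.
have a0 := nrm_ge0 a.
have cube (x y : R) : 0 <= x -> x <= y -> x ^+ 3 <= y ^+ 3.
  by move=> x0 xy; rewrite lerXn2r // nnegrE; lra.
have big (x : R) : 10 <= x -> 100 * x <= x ^+ 3.
  by move=> x10; rewrite exprSr ler_wpM2r ?expr2 //; nra.
have ac : nrm a <= nrm c.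
  rewrite leNgt; apply/negP=> ca.
  have EM : M = nrm a by apply/max_idPr; lra.
  have := bd 1%N; rewrite EM /Piter /=; have := big (nrm a).
  have := cube (nrm c) (nrm a).
  by case: (i) => /=; rewrite ?Pc ?P0 ?n3; lra.
have EM : M = nrm c by apply/max_idPl; lra.
rewrite EM in bd; split=> //.
have := bd 1%N; rewrite /Piter /=; have := big (nrm c) c10.
by case: (i) => /=; rewrite ?Pc ?P0 ?n3; lra.
Qed.

(** With [X = nrm g], the difference of values is at least [X^3/6 - X >= X^3/8], using [X^2 >= 24],
    while [|g - q|^s <= 4 X^2] for both exponents. *)
Lemma cofactor_lower c a g q h (s : nat) : nrm a <= nrm c -> 10 <= nrm c ->
  (0 < s <= 2)%N -> (g - q) ^+ s * h = Pca c a g - Pca c a q ->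
  nrm q < 4 * nrm c -> nrm (Pca c a q) < 4 * nrm c -> 4 * nrm c <= nrm g ->
  nrm g / 32 <= nrm h.
Proof.
move=> ac c10 s2 E qM PqM gM.
have := Pca_lower (lexx _) ac c10 gM.
have := nrmBl (Pca c a g) (Pca c a q); rewrite -E nrmM nrmX.
have := nrmB g q; have := nrm_ge0 (g - q); have := nrm_ge0 h.
move: (nrm h) (nrm (g - q)) (nrm (Pca c a g)) (nrm (Pca c a q)) PqM (nrm g) gM (nrm q) qM.
move=> H D P Q Q4 X XM y y4 H0 D0 DX PQ PX.
have Ds : D ^+ s <= 4 * X ^+ 2.
  have : D <= 2 * X by lra.
  case: s s2 {E PQ} => [|[|[|s]]] // _ D2; first by rewrite expr1 expr2; nra.
  by rewrite !expr2; nra.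
have DH : D ^+ s * H <= 4 * X ^+ 2 * H by rewrite ler_wpM2r.
have X3 : X ^+ 3 = X * X ^+ 2 by rewrite exprS.
have X2 : 24 <= X ^+ 2 by rewrite expr2; nra.
rewrite leNgt; apply/negP => HX.
have : X ^+ 2 * H <= X ^+ 2 * (X / 32) by rewrite ler_wpM2l; lra.
rewrite [X ^+ 2 * (X / 32)]mulrC; nra.
Qed.

(** The first iterate has modulus at least [4 |c|] and each of the [m] later ones gains a factor
    [|c|]; then [4 / 32 = 1 / 8]. *)
Lemma cofactor_escape n k i c a q h m s : (0 < k)%N -> preper_locus n k i (c, a) ->
  10 <= nrm c -> (0 < s <= 2)%N ->
  let g := Piter m.+1 c a (crit c (~~ i)) in let w := Piter q c a (crit c i) in
  (g - w) ^+ s * h = Pca c a g - Pca c a w ->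
  nrm c ^+ m.+1 / 8 <= nrm h.
Proof.
move=> k0 E c10 s2 g w Eh.
have [ac gM bd] := crit_escape k0 E c10.
have c1 : 1 <= nrm c by lra.
have gE : g = Piter m c a (Pca c a (crit c (~~ i))) by rewrite /g /Piter iterSr.
have gX : 4 * nrm c ^+ m.+1 <= nrm g.
  rewrite gE; apply: le_trans (Piter_expand m (lexx _) ac c10 gM).
  by rewrite exprSr mulrCA ler_wpM2l ?exprn_ge0 ?nrm_ge0.
have := cofactor_lower ac c10 s2 Eh (bd q) (bd q.+1); rewrite -/w.
have : nrm c <= nrm c ^+ m.+1 by rewrite ler_eXnr.
lra.
Qed.

End Growth.

(** * Post-critically finite parameters on a component *)

Lemma cubic_sub (F : numFieldType) (x y c b : F) :
  (x - y) * ((x ^+ 2 + x * y + y ^+ 2) / 3%:R - c / 2%:R * (x + y)) =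
  x ^+ 3 / 3%:R - c / 2%:R * x ^+ 2 + b - (y ^+ 3 / 3%:R - c / 2%:R * y ^+ 2 + b).
Proof. by field. Qed.

(** At a critical point the difference of values has a double zero, whence the exponent 2; [b]
    stands for [a^3]. *)
Lemma cubic_sub_crit0 (F : numFieldType) (x c b : F) :
  (x - 0) ^+ 2 * (x / 3%:R - c / 2%:R) =
  x ^+ 3 / 3%:R - c / 2%:R * x ^+ 2 + b - (0 ^+ 3 / 3%:R - c / 2%:R * 0 ^+ 2 + b).
Proof. by field. Qed.

Lemma cubic_sub_crit1 (F : numFieldType) (x c b : F) :
  (x - c) ^+ 2 * (x / 3%:R + c / 6%:R) =
  x ^+ 3 / 3%:R - c / 2%:R * x ^+ 2 + b - (c ^+ 3 / 3%:R - c / 2%:R * c ^+ 2 + b).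
Proof. by field. Qed.

(** Here [y * (y - c)] is [P'(y)], which supplies [l] when the exponent is 1. *)
Lemma cubic_diff_diag (F : numFieldType) (x y c : F) :
  (x ^+ 2 + x * y + y ^+ 2) / 3%:R - c / 2%:R * (x + y) =
  y * (y - c) + (x - y) * ((x + y + y) / 3%:R - c / 2%:R).
Proof. by field. Qed.

Section Main.
Variable R : realType.
Local Notation C := (R[i]).
Implicit Types (f g : {poly {poly C}}) (c a : C).

Lemma finite_orbit_preper n k c a (w : C) : (0 < k)%N ->
  Piter (n + k) c a w = Piter n c a w -> finite_orbit (Pca c a) w.
Proof.
move=> k0 E; exists [seq Piter j c a w | j <- iota 0 (n + k)] => j.
have [m] := ubnP j; elim: m => // m IH in j * => jm.
have [jn|nj] := ltnP j (n + k)%N; first by apply: map_f; rewrite mem_iota.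
have -> : iter j (Pca c a) w = iter (j - k)%N (Pca c a) w.
  have Ej : j = ((j - (n + k)) + (n + k))%N by rewrite subnK.
  rewrite Ej iterD -[X in iter _ _ X]/(Piter (n + k) c a w) E /Piter -iterD.
  by congr iter; lia.
by apply: IH; lia.
Qed.

Lemma finite_orbit_iter (g : C -> C) m x : finite_orbit g (iter m g x) -> finite_orbit g x.
Proof.
move=> [s Hs]; exists ([seq iter j g x | j <- iota 0 m] ++ s) => j.
rewrite mem_cat; have [jm|mj] := ltnP j m.
  by rewrite (map_f (fun j => iter j g x)) // mem_iota.
by rewrite -(subnK mj) iterD Hs orbT.
Qed.

Lemma pcfP c a i : finite_orbit (Pca c a) (crit c i) ->
  finite_orbit (Pca c a) (crit c (~~ i)) -> pcf (c, a).
Proof. by case: i => ? ?; split. Qed.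

Lemma curve_infinite f (s : seq (C * C)) : f \is monic -> (1 < size f)%N ->
  exists c a, ev f c a = 0 /\ (c, a) \notin s.
Proof.
move=> mf sf.
have [c] := exists_nonroot (monic_neq0 (monic_prod_XsubC s xpredT fst)).
have [a fa] := curve_point c mf sf => nz; exists c, a; split=> //.
apply: contraNN nz => ins; rewrite horner_prod (big_rem _ ins) /=.
by rewrite hornerXsubC subrr mul0r.
Qed.

(** [P] persists as [t] grows, so the largest of finitely many times serves all points. *)
Lemma eventually_on_seq (T : eqType) (P : nat -> T -> Prop) (s : seq T) :
  (forall t z, P t z -> P t.+1 z) ->
  exists M, forall z, z \in s -> (exists t, P t z) -> P M z.
Proof.
move=> Pm; have mono t t' z : (t <= t')%N -> P t z -> P t' z.
  by move/subnK <-; elim: (t' - t)%N => //= m IH /IH; apply: Pm.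
elim: s => [|z s [M HM]]; first by exists 0%N.
have [[t Pt]|nP] := EM (exists t, P t z).
  exists (maxn t M) => y; rewrite inE => /predU1P[-> _|ys H].
    by apply: mono Pt; apply: leq_maxl.
  by apply: mono (HM y ys H); apply: leq_maxr.
by exists M => y; rewrite inE => /predU1P[->//|]; apply: HM.
Qed.

(** First try [l = P'(Q)] with exponent 1. If it vanishes on the whole curve, irreducibility makes
    [Q] one fixed critical point; the exponent is then 2 and [l] is [P''(Q)/2], that is [c/2] or
    [-c/2]. *)
Lemma exists_cofactor f n k i : (0 < k)%N ->
  f \is monic -> (1 < size f)%N -> monic_irreducible f ->
  (forall c a, ev f c a = 0 -> preper_locus n k i (c, a)) ->
  ~ (forall c a, ev f c a = 0 -> pcf (c, a)) ->
  exists s (h : {poly {poly C}} -> {poly {poly C}}) l, [/\ (0 < s <= 2)%N,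
    exists c a, ev f c a = 0 /\ ev l c a != 0,
    forall g c a, ev f c a = 0 ->
      (ev g c a - ev (orbit_poly C n i) c a) ^+ s * ev (h g) c a =
      Pca c a (ev g c a) - Pca c a (ev (orbit_poly C n i) c a) &
    forall g, exists e, forall c a, ev f c a = 0 ->
      ev (h g) c a = ev l c a + (ev g c a - ev (orbit_poly C n i) c a) * ev e c a].
Proof.
move=> k0 mf sf irf fV npcf; set Q := orbit_poly C n i.
pose l := Q * (Q - 'X%:P).
have [H|nH] := EM (exists c a, ev f c a = 0 /\ ev l c a != 0).
  exists 1%N, (fun g => Ppoly_diff g Q), l; split=> // [g c a _|g].
    by rewrite expr1 ev_Ppoly_diff /Pca; apply: cubic_sub.
  exists (Ppoly_diff2 g Q) => c a _.
  rewrite ev_Ppoly_diff cubic_diff_diag ev_Ppoly_diff2 /l.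
  by rewrite (evM Q) evD evN evC hornerX.
have lz c a : ev f c a = 0 -> ev Q c a * (ev Q c a - c) = 0.
  move=> fc; apply: contrapT => /eqP nz; apply: nH; exists c, a; split=> //.
  by rewrite /l evM evD evN evC hornerX.
have Qc : (forall c a, ev f c a = 0 -> ev Q c a = 0) \/
          (forall c a, ev f c a = 0 -> ev Q c a = c).
  have [_ _ irr] := zirreducible_curve mf sf irf.
  have [||H] := irr _ _ (zclosed_curve Q) (zclosed_curve (Q - 'X%:P)).
  - move=> [c a] /= /lz /eqP; rewrite mulf_eq0 => /orP[]/eqP Ez; [by left|right].
    by rewrite evD evN evC hornerX.
  - by move=> H; left => c a fc; apply: (H (c, a)).
  - right=> c a fc; have := H (c, a) fc; rewrite /= evD evN evC hornerX.
    by move/eqP; rewrite subr_eq0 => /eqP.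
have {lz}Qi c a : ev f c a = 0 -> ev Q c a = crit c i.
  (* Were [Q] the other critical point, that one would be periodic too and every parameter on the
     curve post-critically finite. *)
  suff : (forall c a, ev f c a = 0 -> ev Q c a = crit c i) \/
         (forall c a, ev f c a = 0 -> ev Q c a = crit c (~~ i)).
    case=> [|H]; first exact.
    case: npcf => {}c {}a fc; have fo := finite_orbit_preper k0 (fV c a fc).
    apply: (pcfP fo).
    rewrite -(H c a fc) /Q ev_orbit_poly; apply: (@finite_orbit_preper 0 k) => //.
    have := fV c a fc; rewrite /preper_locus /= addnC /Piter iterD; exact.
  by case: (i) Qc => /= -[]; [right|left|left|right].
(* Any point with [c] nonzero shows that [l] is not identically zero. *)
have [a1 fa1] := curve_point (1 : C) mf sf.
exists 2%N; case: i => /= in Q @l nH Qi Qc fV npcf *.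
- exists (fun g => 3%:R^-1%:P%:P * g + (6%:R^-1 *: 'X)%:P), (2%:R^-1 *: 'X)%:P; split=> //.
  + by exists 1, a1; rewrite evC hornerZ hornerX mulr1 invr_eq0 pnatr_eq0.
  + move=> g c a /Qi ->; rewrite evD (evM _ g) evCC evC hornerZ hornerX.
    by rewrite [_^-1 * _]mulrC [_^-1 * c]mulrC; apply: cubic_sub_crit1.
  + move=> g; exists 3%:R^-1%:P%:P => c a /Qi ->.
    rewrite evD (evM _ g) evCC !evC !hornerZ !hornerX.
    by field.
- exists (fun g => 3%:R^-1%:P%:P * g - (2%:R^-1 *: 'X)%:P), (- (2%:R^-1 *: 'X)%:P); split=> //.
  + by exists 1, a1; rewrite evN evC hornerZ hornerX mulr1 oppr_eq0 invr_eq0 pnatr_eq0.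
  + move=> g c a /Qi ->; rewrite evD evN (evM _ g) evCC evC hornerZ hornerX.
    by rewrite [_^-1 * _]mulrC [_^-1 * c]mulrC; apply: cubic_sub_crit0.
  + move=> g; exists 3%:R^-1%:P%:P => c a /Qi ->.
    rewrite evD evN (evM _ g) evCC !evC !hornerZ !hornerX.
    by field.
Qed.

Lemma preper_curve_pcf f n k i (s : seq (C * C)) : (0 < k)%N ->
  f \is monic -> (1 < size f)%N -> monic_irreducible f ->
  (forall c a, ev f c a = 0 -> preper_locus n k i (c, a)) ->
  exists c a, [/\ ev f c a = 0, pcf (c, a) & (c, a) \notin s].
Proof.
move=> k0 mf sf irf fV; apply: contrapT => nex.
have pcf_s c a : ev f c a = 0 -> pcf (c, a) -> (c, a) \in s.
  by move=> fc pc; apply/negPn/negP=> ns; apply: nex; exists c, a.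
have npcf : ~ (forall c a, ev f c a = 0 -> pcf (c, a)).
  move=> H; have [c [a [fc ns]]] := curve_infinite s mf sf.
  by move/negP: ns; apply; apply: pcf_s => //; apply: H.
have [p [h [l [p2 lz hE hl]]]] := exists_cofactor k0 mf sf irf fV npcf.
set Q := orbit_poly C n i in hE hl.
pose G t := orbit_poly C (k * t) (~~ i); pose D t := G t - Q.
have evDt t c a : ev (D t) c a = ev (G t) c a - ev Q c a by rewrite evD evN.
have Dstep t : exists e, forall c a, ev f c a = 0 ->
    ev (D t.+1) c a = ev (D t) c a * ev (h (G t)) c a * ev e c a.
  have [e Ee] := iter_Ppoly_sub k.-1 (G t) Q; rewrite prednK // in Ee.
  (* Of the [p] factors [D t] in the difference of values, one is displayed and the others join the
     cofactor. *)
  exists (D t ^+ p.-1 * e) => c a fc.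
  have EQ : ev (iter k (@Ppoly C) Q) c a = ev Q c a.
    rewrite ev_iter_Ppoly /Q ev_orbit_poly /Piter -iterD addnC; exact: (fV c a fc).
  have EG : G t.+1 = iter k (@Ppoly C) (G t) by rewrite /G /orbit_poly mulnS iterD.
  rewrite evDt EG -EQ -evN -evD Ee (evM _ e) evD evN !ev_Ppoly -hE // -evDt.
  rewrite (evM _ e) evX; case: (p) p2 => // q _; rewrite exprS /=.
  by rewrite !mulrA -![_ * ev (h _) _ _]mulrA [_ ^+ q * _]mulrC !mulrA.
have Dpcf t c a : ev f c a = 0 -> ev (D t) c a = 0 -> pcf (c, a).
  move=> fc; rewrite evDt !ev_orbit_poly => /eqP; rewrite subr_eq0 => /eqP E.
  have fo := finite_orbit_preper k0 (fV c a fc); apply: (pcfP fo).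
  apply: (@finite_orbit_iter _ (k * t)%N); rewrite -/(Piter _ _ _ _) E.
  apply: (@finite_orbit_preper 0 k) => //.
  have := fV c a fc; rewrite /preper_locus /= addnC /Piter iterD; exact.
pose vanish t (z : C * C) := ev f z.1 z.2 = 0 /\ ev (D t) z.1 z.2 = 0.
have vanishS t z : vanish t z -> vanish t.+1 z.
  by move=> [fz Dz]; have [e He] := Dstep t; split=> //; rewrite He // Dz !mul0r.
(* Zeros of [D t] persist, and those on the curve all lie in the finite list [s]. *)
have [M HM] := eventually_on_seq s vanishS.
have [] := @eventually_divides _ f l D (fun t => h (G t)) M mf sf irf lz Dstep.
- by move=> t; have [e He] := hl (G t); exists e => c a fc; rewrite He // evDt.
(* A zero of [h (G t)] is a zero of [D t.+1], hence post-critically finite, hence in [s]. *)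
- move=> t c a fc hc; have [e He] := Dstep t.
  have D0 : ev (D t.+1) c a = 0 by rewrite He // hc mulr0 mul0r.
  by have [] := HM (c, a) (pcf_s _ _ fc (Dpcf _ _ _ fc D0)) (ex_intro _ t.+1 (conj fc D0)).
move=> T HT.
have [Nl HNl] := curve_norm l mf sf.
(* Past [T] for divisibility, and large enough that [(k * t).-1] is at least [size Nl], which bounds
   [size Nh]. *)
pose t := (maxn T (size Nl)).+1.
have [b Hb] := HT t (leqW (leq_maxl _ _)).
have [Nh HNh] := curve_norm (h (G t)) mf sf.
have [Nb HNb] := curve_norm b mf sf.
have on_fibre c rs z : fibre c f = \prod_(z <- rs) ('X - z%:P) -> z \in rs -> ev f c z = 0.
  move=> E zr; rewrite ev_fibre E horner_prod (big_rem _ zr) /=.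
  by rewrite hornerXsubC subrr mul0r.
have EN : Nl = Nh * Nb.
  apply: poly_fun_eq => c; have [rs E _] := fibre_roots c mf.
  rewrite hornerM (HNl c rs E) (HNh c rs E) (HNb c rs E) -big_split /=.
  by rewrite big_seq [RHS]big_seq; apply: eq_bigr => z /(on_fibre c rs z E) /Hb.
(* Above a [c] outside the roots of the eliminant of [f] and [l], no factor of the norm vanishes. *)
have Nl0 : Nl != 0.
  have [c0 [a0 [fz lnz]]] := lz.
  have [u [v [r [r0 Er]]]] := bezout_of_nonvanishing mf sf irf fz lnz.
  have [c rc] := exists_nonroot r0; have [rs E _] := fibre_roots c mf.
  apply: contraNneq rc => N0; have := HNl c rs E; rewrite N0 horner0 => /esym/eqP.
  rewrite prodf_seq_eq0 => /hasP[z zr /= /eqP lz0].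
  have /(congr1 (fun p => ev p c z)) := Er.
  rewrite evD (evM u) (evM v) evC (on_fibre c rs z E zr) lz0 !mulr0 addr0 => <-.
  by rewrite eqxx.
have sN : (size Nh <= size Nl)%N by rewrite EN size_factor_le // -EN.
have [B B0 HB] := nrm_horner_le Nh.
(* The 10 ensures escape; [8 * B] makes [x ^+ (k * t) / 8] exceed [B * x ^+ (k * t).-1]. *)
pose x : R := 10 + 8 * B; pose c := (x%:C)%C : C.
have x10 : 10 <= x by rewrite /x; lra.
have cx : nrm c = x by rewrite nrm_real //; lra.
have [rs E srs] := fibre_roots c mf.
have kt : (size Nh <= (k * t).-1)%N.
  apply: leq_trans sN _; rewrite /t; case: (k) k0 => // k' _.
  by move: (leq_maxr T (size Nl)); lia.
have kt0 : (0 < k * t)%N by rewrite muln_gt0 k0.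
have low z : z \in rs -> x ^+ (k * t) / 8 <= nrm (ev (h (G t)) c z).
  move=> zr; have fc := on_fibre c rs z E zr.
  rewrite -cx -(prednK kt0).
  apply: (@cofactor_escape R n k i c z n _ _ p k0 (fV c z fc)) => //.
    by rewrite cx.
  by rewrite prednK // -!ev_orbit_poly; apply: hE.
have xk : x ^+ (k * t).-1 >= 1 by rewrite exprn_ege1 //; lra.
have xE : x ^+ (k * t) = x * x ^+ (k * t).-1 by rewrite -exprS prednK.
have x1 : 1 <= x by lra.
have := HB c; rewrite cx (HNh c rs E) nrm_prod => /(_ x1).
have : x ^+ (k * t) / 8 <= \prod_(z <- rs) nrm (ev (h (G t)) c z).
  (* All factors are at least 1 and the fibre is nonempty, so the bound for a single factor bounds
     the product. *)
  have y1 : 1 <= x ^+ (k * t) / 8 by rewrite xE; nra.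
  case: rs E srs low => [_ srs|z rs _ _ low]; first by move: sf; case: (size f) srs => [|[]].
  rewrite big_cons -[leLHS]mulr1; apply: ler_pM; try lra.
    by apply: low; rewrite mem_head.
  rewrite big_seq; elim/big_ind: _ => // [u v u1 v1|y yr]; first by nra.
  by apply: le_trans y1 (low y _); rewrite inE yr orbT.
have : B * x ^+ (size Nh).-1 <= B * x ^+ (k * t).-1.
  by rewrite ler_wpM2l // ler_weXn2l //; lia.
rewrite xE; move: (x ^+ (k * t).-1) xk => y y1.
have -> : x * y / 8 = 10 / 8 * y + B * y by rewrite /x; field.
by move: (B * y) (B * _) (\prod_(_ <- _) _) => u v w; clear -y1; lra.
Qed.

End Main.

Theorem lemma5p2 (R : realType) (n k : nat) (i : bool) (K : R[i] * R[i] -> Prop) :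
  (0 < k)%N ->
  irr_component (preper_locus n k i) K ->
  infinite2 (fun z => K z /\ pcf z).
Proof.
move=> k0; have [F mF FP] := preper_poly R n i k0.
have -> : preper_locus n k i = (fun z : R[i] * R[i] => ev F z.1 z.2 = 0).
  by apply/funext=> z; apply/propext.
move=> irrK; have [_ KV _] := irrK.
have [f [mf sf irf Kf]] := component_curve mF irrK.
move=> s; have [|c [a [fc pc ns]]] := @preper_curve_pcf R f n k i s k0 mf sf irf.
  by move=> c a fc; apply/FP/KV/Kf.
by exists (c, a); split=> //; split=> //; apply/Kf.
Qed.
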